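(* Let $U_1=\{u\in(\mathbb Z/333\mathbb Z)^\times: u\equiv1\pmod 3\}$. Then $U_1$ has exactly $30$ subgroups. The nine subgroups $$\{1\},\ \langle73\rangle,\ \langle112\rangle,\ \langle10\rangle,\ \langle121\rangle,\ \langle211\rangle,\ \langle73,112\rangle,\ \langle73,85\rangle,\ \langle73,121\rangle$$ are pairwise distinct and have orders $1,2,3,3,3,3,6,6,6$, respectively. For every one of the remaining $21$ subgroups $H$ of $U_1$, no $H$-invariant Legendre pair of length $333$ exists. In particular, for all subgroups $H\le U_1$ with $|H|\ge 9$, of which there are exactly $19$, no $H$-invariant Legendre pair of length $333$ exists.
   Context: Sequence indices are taken modulo the sequence length. For a real sequence $x=(x_0,\dots,x_{L-1})$, its periodic autocorrelation is $\operatorname{PAF}_x(s)=\sum_{j=0}^{L-1}x_jx_{j+s}$. For odd $L$, two sequences $a,b\in\{\pm1\}^L$ form a Legendre pair (of length $L$) if $\operatorname{PAF}_a(s)+\operatorname{PAF}_b(s)=-2$ for all $1\le s<L$. For $H\leq(\mathbb Z/L\mathbb Z)^\times$, a sequence $x$ indexed by $\mathbb Z_L$ is $H$-invariant if $x_{hi}=x_i$ for all $h\in H$ and $i\in\mathbb Z_L$. A Legendre pair is $H$-invariant if both of its sequences are $H$-invariant. Angle brackets $\langle\cdot\rangle$ denote the subgroup of $(\mathbb Z/333\mathbb Z)^\times$ generated by the listed residues modulo $333$. *)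

(* Defs.v *)
From HB Require Import structures.
From mathcomp Require Import all_boot all_order all_algebra all_fingroup.
From mathcomp Require Import reals.

Set Implicit Arguments.
Unset Strict Implicit.
Unset Printing Implicit Defensive.

Import GRing.Theory.
Local Open Scope ring_scope.

(* Sequences of length L are functions on 'Z_L, so that index arithmetic is
   modulo L; this is meaningful only for L > 1, since 'Z_0 and 'Z_1 are Z/2. *)
Definition PAF (R : realType) (L : nat) (x : 'Z_L -> R) (s : 'Z_L) : R :=
  \sum_(j : 'Z_L) x j * x (j + s).

Definition pm1_seq (R : realType) (L : nat) (x : 'Z_L -> R) : Prop :=
  forall i : 'Z_L, x i = 1 \/ x i = -1.

Definition legendre_pair (R : realType) (L : nat) (a b : 'Z_L -> R) : Prop :=
  [/\ odd L, pm1_seq a, pm1_seq b &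
      forall s : nat, (1 <= s < L)%N -> PAF a s%:R + PAF b s%:R = -2].

Definition invariant_seq (R : realType) (L : nat) (H : {group {unit 'Z_L}})
    (x : 'Z_L -> R) : Prop :=
  forall (h : {unit 'Z_L}) (i : 'Z_L), h \in H -> x (FinRing.uval h * i) = x i.

Definition invariant_legendre_pair (R : realType) (L : nat)
    (H : {group {unit 'Z_L}}) (a b : 'Z_L -> R) : Prop :=
  [/\ legendre_pair a b, invariant_seq H a & invariant_seq H b].

Definition Zunit (L n : nat) (L_gt1 : (1 < L)%N) (co_Ln : coprime L n) :
    {unit 'Z_L} :=
  FinRing.unit 'Z_L (etrans (unitZpE n L_gt1) co_Ln).

(* The coprimality of 333 and n is checked by computation. *)
Notation res333 n := (@Zunit 333 n isT isT) (only parsing).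

Definition U1 : {set {unit 'Z_333}} :=
  [set u : {unit 'Z_333} | (FinRing.uval u : nat) == 1 %[mod 3]].

Lemma U1_group_set : group_set U1.
Proof.
apply/group_setP; split=> [|x y]; rewrite !inE //= => /eqP x1 /eqP y1.
by rewrite modn_dvdm // -modnMml x1 modnMml mul1n y1.
Qed.

Canonical U1_group := Group U1_group_set.

Definition nine_subgroups : seq {group {unit 'Z_333}} :=
  [:: 1%G;
      <[res333 73]>%G;
      <[res333 112]>%G;
      <[res333 10]>%G;
      <[res333 121]>%G;
      <[res333 211]>%G;
      <<[set res333 73; res333 112]>>%G;
      <<[set res333 73; res333 85]>>%G;
      <<[set res333 73; res333 121]>>%G].

(* Main.v *)
Require Import Defs.
From HB Require Import structures.
From mathcomp Require Import all_boot all_order all_algebra all_fingroup all_field.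
From mathcomp Require Import reals.
From mathcomp Require Import zify ring.

Set Implicit Arguments.
Unset Strict Implicit.
Unset Printing Implicit Defensive.

Import Order.TTheory GRing.Theory Num.Theory.
Local Open Scope ring_scope.

(** Proof idea.  Write Z/333 = Z/9 x Z/37.  Each subgroup of U1 outside the nine
    contains a unit with one of the residue pairs (4,1), (4,16), (7,16), (1,16),
    (1,27), (1,6) modulo (9,37), and invariance under each is impossible.
    - (4,1): both correlations at the shift (3,0) are at least 185.
    - (4,16), (7,16): let c, d be the 9-compressions.  The squared moduli of
      c_0 + c_3 w + c_6 w^2 and of its analogue for d, w a cube root of unity, add
      up to 668; modulo 9 each of them is 0 or 4, while 668 = 2.
    - (1,16), (1,27): c = f + m h with f a sign vector, h integral and m = 18 or
      m = 12.  Expanding the correlations of c and d in powers of m leaves no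
      solution for m = 18 and only sparse h, excluded by a finite search, for m = 12.
    - (1,6): the Fourier coefficients x, y of the 37-compressions satisfy
      x^2 + y^2 = 668 = 4 * 167.  In characteristic 167 they lie in a field with
      167^9 elements, where -1 is not a square, so they vanish; hence both
      37-compressions are constant, against their correlation being negative. *)

(** * Reduction to sequences on Z/9 x Z/37 *)

Definition is_sign (x : int) := x = 1 \/ x = -1.

Definition corr (T : finZmodType) (x : T -> int) (s : T) : int :=
  \sum_j x j * x (j + s).

Definition corr2 (T U : finZmodType) (x : T -> U -> int) (s : T) (t : U) : int :=
  \sum_i \sum_g x i g * x (i + s) (g + t).

(** For fixed rows the sum over [t] runs through all pairs of entries, so summing the
    two-dimensional correlations leaves the correlation of the row sums. *)
Lemma corr_sumr (T U : finZmodType) (x : T -> U -> int) (s : T) :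
  corr (fun i => \sum_g x i g) s = \sum_t corr2 x s t.
Proof.
rewrite /corr /corr2 exchange_big /=; apply: eq_bigr => i _.
rewrite exchange_big /= mulr_suml; apply: eq_bigr => g _.
by rewrite mulr_sumr (reindex_inj (addrI g)).
Qed.

Lemma corr_suml (T U : finZmodType) (x : T -> U -> int) (t : U) :
  corr (fun g => \sum_i x i g) t = \sum_s corr2 x s t.
Proof.
rewrite (_ : \sum_s _ = \sum_s corr2 (fun g i => x i g) t s); last first.
  by apply: eq_bigr => s _; rewrite /corr2 exchange_big.
exact: corr_sumr.
Qed.

Definition crt (j : 'Z_333) : 'Z_9 * 'Z_37 := (inZp j, inZp j).

Lemma crt_bij : bijective crt.
Proof.
apply: inj_card_bij; last by rewrite card_prod !card_ord.
move=> j k [] /eqP e9 /eqP e37; apply: val_inj.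
have := chinese_remainder (isT : coprime 9 37) j k.
by rewrite e9 e37 !modn_small // => /eqP.
Qed.

Lemma crtD j k : crt (j + k) = ((crt j).1 + (crt k).1, (crt j).2 + (crt k).2).
Proof. by congr pair; apply: val_inj; rewrite /= modnDm modn_dvdm. Qed.

Lemma crtM j k : crt (j * k) = ((crt j).1 * (crt k).1, (crt j).2 * (crt k).2).
Proof. by congr pair; apply: val_inj; rewrite /= modnMm modn_dvdm. Qed.

Record legendre2 (y z : 'Z_9 -> 'Z_37 -> int) : Prop := Legendre2 {
  sign_l : forall i g, is_sign (y i g);
  sign_r : forall i g, is_sign (z i g);
  corr_lr : forall s t, (s, t) != (0, 0) -> corr2 y s t + corr2 z s t = -2 }.

(** The Chinese remainder bijection respects addition, which carries over the correlations, and
    multiplication, so a multiplier u acts through its two residues. The entries become integers,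
    open to divisibility arguments. *)
Lemma legendre_crt (R : realType) (a b : 'Z_333 -> R) : legendre_pair a b ->
  exists y z, legendre2 y z /\
    forall u, (forall j, a (u * j) = a j) -> (forall j, b (u * j) = b j) ->
      (forall i g, y ((crt u).1 * i) ((crt u).2 * g) = y i g) /\
      (forall i g, z ((crt u).1 * i) ((crt u).2 * g) = z i g).
Proof.
case=> _ a_sgn b_sgn ab; have [psi psiK crtK] := crt_bij.
pose sg (x : 'Z_333 -> R) i g : int := if x (psi (i, g)) == 1 then 1 else -1.
have sgE x i g : pm1_seq x -> x (psi (i, g)) = (sg x i g)%:~R.
  by move=> x_sgn; rewrite /sg; case: (x_sgn (psi (i, g))) => ->;
    rewrite ?eqxx // eq_sym -subr_eq0 opprK -mulr2n pnatr_eq0.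
have psiD p q : psi (p.1 + q.1, p.2 + q.2) = psi p + psi q.
  by apply: (can_inj psiK); rewrite crtD !crtK.
have corrE x s t : pm1_seq x -> (corr2 (sg x) s t)%:~R = PAF x (psi (s, t)).
  move=> x_sgn; rewrite /PAF (reindex psi); last by exists crt => p _ //; rewrite crtK.
  rewrite /corr2 pair_big /= rmorph_sum; apply: eq_bigr => [[i g]] _ /=.
  by rewrite rmorphM /= -!sgE // -psiD.
have psiM u i g : psi ((crt u).1 * i, (crt u).2 * g) = u * psi (i, g).
  by apply: (can_inj psiK); rewrite crtM !crtK.
exists (sg a), (sg b); split; first split.
- by move=> i g; rewrite /sg; case: ifP; [left | right].
- by move=> i g; rewrite /sg; case: ifP; [left | right].
- move=> s t st0; apply: (@intr_inj R); rewrite rmorphD /= !corrE //.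
  have psi0 : psi (s, t) != 0.
    by apply: contra st0 => /eqP psi0; rewrite -(crtK (s, t)) psi0.
  rewrite -(natr_Zp (psi (s, t))) ab ?rmorphN //.
  by rewrite lt0n psi0 /= ltn_ord.
- by move=> u ua ub; split=> i g; rewrite /sg psiM ?ua ?ub.
Qed.

(** * Explicit sums over Z/9 and Z/37 *)

Lemma sum_Z9 (F : 'Z_9 -> int) :
  \sum_i F i = F 0%:R + F 1%:R + F 2%:R + F 3%:R + F 4%:R + F 5%:R + F 6%:R
               + F 7%:R + F 8%:R.
Proof.
rewrite (eq_bigr (fun i : 'I_9 => F (i : nat)%:R)); last by move=> i _; rewrite natr_Zp.
rewrite -(big_mkord xpredT (fun i => F i%:R)) /= !big_nat_recr //= big_geq //.
by rewrite add0r.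
Qed.

Lemma natr_Z9D (n m : nat) : (n%:R + m%:R : 'Z_9) = ((n + m) %% 9)%:R.
Proof. by rewrite -natrD; apply: val_inj; rewrite /= !val_Zp_nat // modn_mod. Qed.

(** 2 is a primitive root modulo 37: zero and 36 powers of 2 are 37 distinct elements, hence all of
    them. *)
Lemma mem_Z37_pow2 (g : 'Z_37) : g \in 0 :: [seq 2%:R ^+ k | k <- iota 0 36].
Proof.
have [|h _||_ e] := @uniq_min_size _ (0 :: [seq 2%:R ^+ k | k <- iota 0 36])
                      (index_enum 'Z_37).
- by vm_compute.
- by rewrite mem_index_enum.
- by rewrite -[index_enum _]/(Finite.enum _) -enumT -cardE card_ord.
- by rewrite e mem_index_enum.
Qed.

Lemma sum_Z37_pow2 (F : 'Z_37 -> int) :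
  \sum_g F g = F 0 + \sum_(0 <= k < 36) F (2%:R ^+ k).
Proof.
have -> : \sum_g F g = \sum_(g <- 0 :: [seq 2%:R ^+ k | k <- iota 0 36] : seq 'Z_37) F g.
  apply: perm_big; apply: uniq_perm; first exact: index_enum_uniq.
    by vm_compute.
  by move=> g; rewrite mem_index_enum mem_Z37_pow2.
by rewrite big_cons big_map /index_iota.
Qed.

Lemma sum_Z37_orbits (F : 'Z_37 -> int) m : m != 0%N ->
  (forall g, F (2%:R ^+ m * g) = F g) ->
  \sum_g F g = F 0 + \sum_(0 <= k < 36) F (2%:R ^+ (k %% m)).
Proof.
move=> m0 Fm; rewrite sum_Z37_pow2; congr (_ + _); apply: eq_bigr => k _.
rewrite {1}(divn_eq k m) exprD mulnC exprM.
by elim: (k %/ m)%N => [|q IH]; rewrite ?mul1r // exprS -mulrA Fm.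
Qed.

Lemma sign_odd x : is_sign x -> exists b, x = 1 + 2 * b.
Proof. by case=> ->; [exists 0 | exists (-1)]. Qed.

(** Since 16 = 2^4, the nonzero residues fall into four orbits of nine elements; a sum of four signs
    is even, whence the factor 18. *)
Lemma sum_Z37_16 (F : 'Z_37 -> int) : (forall g, is_sign (F g)) ->
  (forall g, F (16%:R * g) = F g) -> exists u, \sum_g F g = F 0 + 18 * u.
Proof.
move=> Fs F16; rewrite (@sum_Z37_orbits _ 4) //; last first.
  by move=> g; rewrite -[in RHS]F16; congr (F (_ * g)); apply/eqP.
have [b0 E0] := sign_odd (Fs (2%:R ^+ 0)).
have [b1 E1] := sign_odd (Fs (2%:R ^+ 1)).
have [b2 E2] := sign_odd (Fs (2%:R ^+ 2)).
have [b3 E3] := sign_odd (Fs (2%:R ^+ 3)).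
exists (2 + b0 + b1 + b2 + b3).
rewrite unlock /index_iota /= E0 E1 E2 E3; ring.
Qed.

(** Since 27 = 2^6, there are six orbits of six elements; a sum of six signs is even, whence the
    factor 12. *)
Lemma sum_Z37_27 (F : 'Z_37 -> int) : (forall g, is_sign (F g)) ->
  (forall g, F (27%:R * g) = F g) -> exists u, \sum_g F g = F 0 + 12 * u.
Proof.
move=> Fs F27; rewrite (@sum_Z37_orbits _ 6) //; last first.
  by move=> g; rewrite -[in RHS]F27; congr (F (_ * g)); apply/eqP.
have [b0 E0] := sign_odd (Fs (2%:R ^+ 0)).
have [b1 E1] := sign_odd (Fs (2%:R ^+ 1)).
have [b2 E2] := sign_odd (Fs (2%:R ^+ 2)).
have [b3 E3] := sign_odd (Fs (2%:R ^+ 3)).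
have [b4 E4] := sign_odd (Fs (2%:R ^+ 4)).
have [b5 E5] := sign_odd (Fs (2%:R ^+ 5)).
exists (3 + b0 + b1 + b2 + b3 + b4 + b5).
rewrite unlock /index_iota /= E0 E1 E2 E3 E4 E5; ring.
Qed.

(** * Compressions to lengths 9 and 37 *)

Definition compress9 (y : 'Z_9 -> 'Z_37 -> int) i := \sum_g y i g.
Definition compress37 (y : 'Z_9 -> 'Z_37 -> int) g := \sum_i y i g.

Section Compression.
Variables (y z : 'Z_9 -> 'Z_37 -> int) (yz : legendre2 y z).

Lemma corr2_00 : corr2 y 0 0 + corr2 z 0 0 = 666.
Proof.
have sq x : (forall i g, is_sign (x i g)) -> corr2 x (0 : 'Z_9) (0 : 'Z_37) = 333.
  move=> xs; rewrite /corr2 (eq_bigr (fun=> 37)); last first.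
    move=> i _; rewrite (eq_bigr (fun=> 1)) ?sumr_const ?card_ord //.
    by move=> g _; rewrite !addr0; case: (xs i g) => ->.
  by rewrite sumr_const card_ord.
by rewrite !sq //; [apply: sign_r yz | apply: sign_l yz].
Qed.

(** Of the 37 terms at s = 0 one is 666 and the others are -2, which gives 594; for s != 0 all are
    -2, which gives -74. *)
Lemma corr_compress9 s :
  corr (compress9 y) s + corr (compress9 z) s = if s == 0 then 594 else -74.
Proof.
rewrite !corr_sumr -big_split (bigD1 0) //= (eq_bigr (fun=> -2)); last first.
  by move=> t t0; rewrite (corr_lr yz) // xpair_eqE negb_and t0 orbT.
rewrite sumr_const cardC1 card_ord.
by case: eqP => [->|/eqP s0]; rewrite ?corr2_00 ?(corr_lr yz) // xpair_eqE negb_and s0.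
Qed.

(** Here 650 = 666 - 8 * 2 and -18 = 9 * -2. *)
Lemma corr_compress37 t :
  corr (compress37 y) t + corr (compress37 z) t = if t == 0 then 650 else -18.
Proof.
rewrite !corr_suml -big_split (bigD1 0) //= (eq_bigr (fun=> -2)); last first.
  by move=> s s0; rewrite (corr_lr yz) // xpair_eqE negb_and s0.
rewrite sumr_const cardC1 card_ord.
by case: eqP => [->|/eqP t0]; rewrite ?corr2_00 ?(corr_lr yz) // xpair_eqE negb_and t0 orbT.
Qed.

End Compression.

(** * Invariance by (4,1) *)

Lemma dilation4_orbits (F : 'Z_9 -> int) : (forall i, F (4%:R * i) = F i) ->
  [/\ F 4%:R = F 1%:R, F 7%:R = F 1%:R, F 8%:R = F 2%:R & F 5%:R = F 2%:R].
Proof.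
move=> F4; have F16 i : F (7%:R * i) = F i.
  by rewrite -[RHS]F4 -[RHS]F4 mulrA; congr (F (_ * _)); apply/eqP.
by split; [rewrite -[RHS]F4 | rewrite -[RHS]F16 | rewrite -[RHS]F4 | rewrite -[RHS]F16];
   congr F; apply/eqP.
Qed.

(** The shift by 3 preserves the orbits {1,4,7} and {2,5,8}, on which F is constant, so each
    contributes 3; the three products of signs on {0,3,6} add up to 3 or -1. *)
Lemma corr9_3_ge (F : 'Z_9 -> int) : (forall i, is_sign (F i)) ->
  (forall i, F (4%:R * i) = F i) -> 5 <= corr F 3%:R.
Proof.
move=> Fs F4; rewrite /corr sum_Z9 !natr_Z9D.
have [E4 E7 E8 E5] := dilation4_orbits F4.
rewrite /= E4 E7 E8 E5.
by case: (Fs 0%:R) => ->; case: (Fs 1%:R) => ->; case: (Fs 2%:R) => ->;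
   case: (Fs 3%:R) => ->; case: (Fs 6%:R) => ->.
Qed.

Lemma no_legendre_4_1 y z : legendre2 y z ->
  (forall i g, y (4%:R * i) g = y i g) -> (forall i g, z (4%:R * i) g = z i g) -> False.
Proof.
move=> yz y4 z4.
have ge x : (forall i g, is_sign (x i g)) -> (forall i g, x (4%:R * i) g = x i g) ->
    185 <= corr2 x (3%:R : 'Z_9) (0 : 'Z_37).
  move=> xs x4; rewrite /corr2 exchange_big /=.
  rewrite (_ : 185 = \sum_(g : 'Z_37) 5); last by rewrite sumr_const card_ord.
  apply: ler_sum => g _; rewrite (eq_bigr (fun i => x i g * x (i + 3%:R) g)).
    by apply: (@corr9_3_ge (fun i => x i g)) => i; [apply: xs | apply: x4].
  by move=> i _; rewrite addr0.
have : 185 + 185 <= -2 :> int; last by [].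
rewrite -(corr_lr yz (isT : (3%:R, 0) != (0, 0) :> 'Z_9 * 'Z_37)).
by apply: lerD; [apply: ge y4; apply: sign_l yz | apply: ge z4; apply: sign_r yz].
Qed.

(** * Invariance by (4,16) and (7,16) *)

Lemma sum_Z37_dilation n (F : 'Z_37 -> int) : coprime 37 n ->
  \sum_g F (n%:R * g) = \sum_g F g.
Proof.
move=> co; rewrite [RHS](reindex_inj (@mulrI _ (n%:R : 'Z_37) _)) //.
by rewrite unitZpE.
Qed.

(* corr c 0 - corr c 3 is the squared modulus of c 0 + c 3 w + c 6 w^2, w a cube root of
   unity; modulo 9 it is that of a sign vector, hence 0 or 4. *)
Lemma eisenstein_mod9 (c : 'Z_9 -> int) : (forall i, c (4%:R * i) = c i) ->
  (forall j : nat, exists2 e, is_sign e & exists u, c (3 * j)%:R = e + 9 * u) ->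
  exists u, corr c 0 - corr c 3%:R = 9 * u \/ corr c 0 - corr c 3%:R = 4 + 9 * u.
Proof.
move=> c4 c9; rewrite /corr !sum_Z9 !addr0 !natr_Z9D.
have [E4 E7 E8 E5] := dilation4_orbits c4.
rewrite /= E4 E7 E8 E5.
have [e0 s0 [u0 ->]] := c9 0%N.
have [e1 s1 [u1 ->]] := c9 1%N.
have [e2 s2 [u2 ->]] := c9 2%N.
(* The orbits {1,4,7} and {2,5,8} contribute the same at shifts 0 and 3 and cancel. What is left is
   the Eisenstein norm [q], whose value on signs is 0 if they agree and 4 otherwise. *)
pose q (a b c : int) := a * a + b * b + c * c - a * b - b * c - c * a.
pose u := 2 * (e0 * u0 + e1 * u1 + e2 * u2) + 9 * (u0 * u0 + u1 * u1 + u2 * u2)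
  - e0 * u1 - e1 * u0 - e1 * u2 - e2 * u1 - e2 * u0 - e0 * u2 - 9 * (u0 * u1 + u1 * u2 + u2 * u0).
exists u; rewrite (_ : _ - _ = q e0 e1 e2 + 9 * u); last by rewrite /q /u; ring.
rewrite /q; case: s0 => ->; case: s1 => ->; case: s2 => ->;
  by [left; rewrite add0r | right].
Qed.

Lemma no_compress9_mod9 (c d : 'Z_9 -> int) :
  corr c 0 + corr d 0 = 594 -> corr c 3%:R + corr d 3%:R = -74 ->
  (forall i, c (4%:R * i) = c i) -> (forall i, d (4%:R * i) = d i) ->
  (forall j : nat, exists2 e, is_sign e & exists u, c (3 * j)%:R = e + 9 * u) ->
  (forall j : nat, exists2 e, is_sign e & exists u, d (3 * j)%:R = e + 9 * u) -> False.
Proof.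
move=> cd0 cd3 c4 d4 c9 d9.
have [u cu] := eisenstein_mod9 c4 c9; have [v dv] := eisenstein_mod9 d4 d9; lia.
Qed.

Lemma no_legendre_4_16 n y z : n \in [:: 4; 7]%N -> legendre2 y z ->
  (forall i g, y (n%:R * i) (16%:R * g) = y i g) ->
  (forall i g, z (n%:R * i) (16%:R * g) = z i g) -> False.
Proof.
move=> n47 yz yn zn.
have dil x : (forall i g, x (n%:R * i) (16%:R * g) = x i g) ->
    forall i, compress9 x (4%:R * i) = compress9 x i.
  move=> xn; have cn i : compress9 x (n%:R * i) = compress9 x i.
    rewrite /compress9 -(@sum_Z37_dilation 16) //; exact: eq_bigr.
  move: n47 cn; rewrite !inE => /orP[] /eqP-> // cn i.
  (* For n = 7, dilating twice by 7 is dilating by 4, as 49 = 4 modulo 9. *)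
  by rewrite -[in LHS]cn mulrA -natrM; congr (compress9 x _);
     rewrite -[RHS]mul1r; congr (_ * _); apply/eqP.
have mod9 x : (forall i g, is_sign (x i g)) ->
   (forall i g, x (n%:R * i) (16%:R * g) = x i g) ->
   forall j : nat, exists2 e, is_sign e & exists u, compress9 x (3 * j)%:R = e + 9 * u.
  move=> xs xn j; exists (x (3 * j)%:R 0); first exact: xs.
  have [|g|u xu] := @sum_Z37_16 (x (3 * j)%:R); first exact: xs.
    (* Both 4 and 7 are 1 modulo 3 and so fix 3j modulo 9: this row is invariant under 16 alone. *)
    rewrite -[LHS]/(x _ _) -[RHS]xn; congr (x _ _).
    rewrite natrM mulrA; congr (_ * _).
    by move: n47; rewrite !inE => /orP[] /eqP->; apply/eqP.
  by exists (2 * u); rewrite /compress9 xu; ring.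
have e0 := corr_compress9 yz 0; have e3 := corr_compress9 yz 3%:R.
exact: (no_compress9_mod9 e0 e3 (dil _ yn) (dil _ zn) (mod9 _ (sign_l yz) yn)
          (mod9 _ (sign_r yz) zn)).
Qed.

(** * Correlations of f + m h, and invariance by (1,16) *)

Definition xcorr (T : finZmodType) (f h : T -> int) (s : T) : int :=
  \sum_j h j * (f (j - s) + f (j + s)).

Section Corr.
Variable T : finZmodType.
Implicit Types f h : T -> int.

Lemma sum_corr f : \sum_s corr f s = (\sum_j f j) * (\sum_j f j).
Proof.
rewrite /corr exchange_big mulr_suml /=; apply: eq_bigr => j _.
by rewrite -mulr_sumr [in RHS](reindex_inj (addrI j)).
Qed.

(** [xcorr] collects the two cross terms, one of them reindexed so that h factors out. *)
Lemma corr_affine f h m s :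
  corr (fun i => f i + m * h i) s = corr f s + m * xcorr f h s + m * m * corr h s.
Proof.
have -> : xcorr f h s = \sum_j f j * h (j + s) + \sum_j h j * f (j + s).
  rewrite /xcorr; under eq_bigr => j _ do rewrite mulrDr.
  rewrite big_split /=; congr (_ + _).
  rewrite [RHS](reindex_inj (addIr (- s))) /=.
  by apply: eq_bigr => j _; rewrite subrK mulrC.
rewrite /corr mulrDr !mulr_sumr -!big_split /=; apply: eq_bigr => j _; ring.
Qed.

Lemma corr_sign_le f s : (forall i, is_sign (f i)) -> `|corr f s| <= #|T|%:R.
Proof.
move=> fs; rewrite /corr (le_trans (ler_norm_sum _ _ _)) //.
rewrite -sumr_const; apply: ler_sum => i _.
by case: (fs i) => ->; case: (fs (i + s)) => ->.
Qed.

(** [corr h 0] is the sum of the squares of h, an integer is bounded by its square, and two signs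
    add up to at most 2. *)
Lemma xcorr_sign_le f h s : (forall i, is_sign (f i)) -> `|xcorr f h s| <= 2 * corr h 0.
Proof.
move=> fs; rewrite /corr mulr_sumr (le_trans (ler_norm_sum _ _ _)) //.
apply: ler_sum => i _; rewrite addr0 normrM.
apply: (@le_trans _ _ (`|h i| * 2)); last first.
  by rewrite [leRHS]mulrC ler_pM2r //; case: (ger0P (h i)) => ?; nia.
apply: ler_wpM2l => //.
by case: (fs (i - s)) => ->; case: (fs (i + s)) => ->.
Qed.

End Corr.

Lemma sum_sign_le (f : 'Z_9 -> int) : (forall i, is_sign (f i)) -> `|\sum_i f i| <= 9.
Proof.
move=> fs; rewrite (le_trans (ler_norm_sum _ _ _)) //.
rewrite (_ : 9 = \sum_(i : 'Z_9) 1); last by rewrite sumr_const card_ord.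
by apply: ler_sum => i _; case: (fs i) => ->.
Qed.

(* q is the sum of the correlations of f and k at s; only its size matters. *)
Lemma compress9_expand (m : int) (f h k l : 'Z_9 -> int) : 12 <= m ->
  (forall i, is_sign (f i)) -> (forall i, is_sign (k i)) ->
  (forall s, corr (fun i => f i + m * h i) s + corr (fun i => k i + m * l i) s
             = if s == 0 then 594 else -74) ->
  [/\ \sum_i h i = 0, \sum_i l i = 0,
      m * (xcorr f h 0 + xcorr k l 0) + m * m * (corr h 0 + corr l 0) = 576
    & forall s, s != 0 -> exists2 q : int, `|q| <= 18 &
        q + m * (xcorr f h s + xcorr k l s) + m * m * (corr h s + corr l s) = -74].
Proof.
move=> m12 fs ks E.
(* Adding over all shifts gives 594 - 8 * 74 = 2 for the sum of the squared totals. *)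
have sumE : (\sum_i (f i + m * h i)) * (\sum_i (f i + m * h i)) +
            (\sum_i (k i + m * l i)) * (\sum_i (k i + m * l i)) = 2.
  rewrite -!sum_corr -big_split (bigD1 0) //= E eqxx (eq_bigr (fun=> -74)).
    by rewrite sumr_const cardC1 card_ord.
  by move=> s /negPf s0; rewrite E s0.
(* A total is at most 1 in absolute value and its signs contribute at most 9, so the multiple of m
   >= 12 in it is zero. *)
have sum0 (u a : 'Z_9 -> int) : (forall i, is_sign (u i)) ->
    (\sum_i (u i + m * a i)) * (\sum_i (u i + m * a i)) <= 2 -> \sum_i a i = 0.
  move=> us; rewrite big_split -mulr_sumr /=; have := sum_sign_le us.
  move: (\sum_i u i) (\sum_i a i) => U A U9 UA.
  have : -1 <= U + m * A <= 1 by move: UA; set W := U + _; clear; nia.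
  by move: (leP 1 A) (leP A (-1)) => [] ? [] ?; nia.
have corr0 (u : 'Z_9 -> int) : (forall i, is_sign (u i)) -> corr u 0 = 9.
  move=> us; rewrite /corr (eq_bigr (fun=> 1)) ?sumr_const ?card_ord // => i _.
  by rewrite addr0; case: (us i) => ->.
split.
- apply: sum0 fs _; nia.
- apply: sum0 ks _; nia.
- have := E 0; rewrite eqxx !corr_affine (corr0 f fs) (corr0 k ks).
  by set X := xcorr f h _; set Y := xcorr k l _; set P := corr h _; set Q := corr l _; lia.
- move=> s /negPf s0; exists (corr f s + corr k s).
    have b (x : 'Z_9 -> int) : (forall i, is_sign (x i)) -> `|corr x s| <= 9.
      by move=> /(corr_sign_le s); rewrite card_ord.
    by have := b f fs; have := b k ks; lia.
  have := E s; rewrite s0 !corr_affine => <-; ring.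
Qed.

Lemma no_compress9_18 (f h k l : 'Z_9 -> int) :
  (forall i, is_sign (f i)) -> (forall i, is_sign (k i)) ->
  (forall s, corr (fun i => f i + 18 * h i) s + corr (fun i => k i + 18 * l i) s
             = if s == 0 then 594 else -74) -> False.
Proof.
move=> fs ks /compress9_expand[] // sh sl e0 es.
have le0 s := conj (xcorr_sign_le h s fs) (xcorr_sign_le l s ks).
(* With N this sum and X the sum of the [xcorr] at 0: X = 32 - 18 N and |X| <= 2 N force N = 2. *)
have N2 : corr h 0 + corr l 0 = 2 by have := le0 0; lia.
(* 324 times the absolute value of this sum is at most 74 + 18 + 18 * 4 = 164. *)
have P0 s : s != 0 -> corr h s + corr l s = 0.
  by move=> /es[q q18]; have := le0 s; lia.
(* Over all shifts the correlations add up to squares of zero sums, yet shift 0 alone gives 2. *)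
have : \sum_s corr h s + \sum_s corr l s = 0 by rewrite !sum_corr sh sl.
by rewrite -big_split (bigD1 0) //= N2 big1.
Qed.

Lemma compress9_split (m : int) x : (forall i g, is_sign (x i g)) ->
  (forall i, exists u, compress9 x i = x i 0 + m * u) ->
  exists f h : 'Z_9 -> int, (forall i, is_sign (f i)) /\
     forall s, corr (compress9 x) s = corr (fun i => f i + m * h i) s.
Proof.
move=> xs xm; exists (x^~ 0), (fun i => divz (compress9 x i - x i 0) m).
split=> // s; apply: eq_bigr => j _.
suff E i : compress9 x i = x i 0 + m * divz (compress9 x i - x i 0) m by rewrite -!E.
have [v ->] := xm i; rewrite [_ + m * v]addrC addrK.
have [->|m0] := eqVneq m 0; first by rewrite !mul0r addrC.
by rewrite mulKz // addrC.
Qed.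

Lemma no_legendre_1_16 y z : legendre2 y z ->
  (forall i g, y i (16%:R * g) = y i g) ->
  (forall i g, z i (16%:R * g) = z i g) -> False.
Proof.
move=> yz y16 z16; have ys := sign_l yz; have zs := sign_r yz.
have [|f [h [fs fE]]] := @compress9_split 18 y ys.
  by move=> i; apply: (sum_Z37_16 (ys i) (y16 i)).
have [|k [l [ks kE]]] := @compress9_split 18 z zs.
  by move=> i; apply: (sum_Z37_16 (zs i) (z16 i)).
by apply: (@no_compress9_18 f h k l) => // s; rewrite -fE -kE (corr_compress9 yz).
Qed.

(** * Invariance by (1,27): a finite search *)

(* The raw integer operations and the nested conditionals (instead of [&&])
   keep the exhaustive search below cheap for the kernel. *)
Fixpoint dot (u v : seq int) : int :=
  match u, v with
  | x :: u', y :: v' =>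
    if x is Posz 0 then dot u' v' else intZmod.addz (intRing.mulz x y) (dot u' v')
  | _, _ => 0
  end.

Fixpoint addseq (u v : seq int) : seq int :=
  match u, v with x :: u', y :: v' => intZmod.addz x y :: addseq u' v' | _, _ => [::] end.

Fixpoint all_lazy (T : Type) (p : T -> bool) (s : seq T) : bool :=
  if s is x :: s' then if p x then all_lazy p s' else false else true.

Fixpoint signs (n : nat) : seq (seq int) :=
  if n is n'.+1 then map (cons 1) (signs n') ++ map (cons (-1)) (signs n') else [:: [::]].

(** Entries are 0, 1 or -1, at most [b] of them nonzero. *)
Fixpoint ternary (n b : nat) : seq (seq int) :=
  if n is n'.+1 then
    map (cons 0) (ternary n' b) ++
    (if b is b'.+1 then map (cons 1) (ternary n' b') ++ map (cons (-1)) (ternary n' b')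
     else [::])
  else [:: [::]].

Definition eq_nat_int (n : nat) (x : int) : bool := if x is Posz m then eqn m n else false.
(** [Negz n] is -(n+1), so here and in the next test the bounds on n are off by one. *)
Definition ge_m11 (y : int) : bool := if y is Negz n then (n <= 10)%N else true.
Definition in_m7_m5 (y : int) : bool :=
  if y is Negz n then if (4 <= n)%N then (n <= 6)%N else false else false.

Definition balanced (n : nat) : seq (seq int) :=
  [seq h <- ternary 9 4 | if eq_nat_int n (dot h h) then
     eq_nat_int 0 (dot (nseq 9 1) h) else false].

(** Shifts 5 to 8 would repeat these values, correlations being even in the shift. *)
Definition acorrs (h : seq int) : seq int := [seq dot h (rot s h) | s <- iota 1 4].
Definition symshifts (f : seq int) : seq (seq int) :=
  [seq addseq (rotr s f) (rot s f) | s <- iota 1 4].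

Definition with_acorrs (h : seq int) := (h, [seq intRing.mulz 12 p | p <- acorrs h]).
Definition with_symshifts (f : seq int) := (f, symshifts f).

(** The excess of a side (f, h) at s is [12 * corr h s + xcorr f h s]; 12 times it is what 12 h adds
    to the correlation of f. *)
Definition all_excess (Q : int -> bool) (hp : seq int * seq int) (g : seq (seq int)) :=
  all_lazy (fun pg => Q (intZmod.addz pg.1 (dot hp.1 pg.2))) (zip hp.2 g).
(** All that one side contributes to the conditions: its part of the shift-0 equation, then its
    excesses. Pairs of distinct keys replace pairs of sides. *)
Definition key (hp : seq int * seq int) (fg : seq int * seq (seq int)) : seq int :=
  dot hp.1 fg.1 :: [seq intZmod.addz pg.1 (dot hp.1 pg.2) | pg <- zip hp.2 fg.2].

Definition signed := [seq with_symshifts f | f <- signs 9].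

Fixpoint insert_new (k : seq int) (K : seq (seq int)) : seq (seq int) :=
  if K is k' :: K' then if k == k' then K else k' :: insert_new k K' else [:: k].

(* Two sides are combined if their excesses add up to at least -7; a side with
   two nonzero entries has excess at most 4, whence the bound -11. *)
Definition keys2 : seq (seq int) := let S := signed in
  foldr insert_new [::] (flatten [seq let hp := with_acorrs h in
                      [seq key hp fg | fg <- S & all_excess ge_m11 hp fg.2]
                 | h <- balanced 2]).

Definition compatible (k k' : seq int) : bool :=
  if addseq k k' is x :: y then
    if eq_nat_int 0 x then all_lazy in_m7_m5 y else false
  else false.

(** The case where the other side has l = 0. Excesses between -7 and -5 with |xcorr| <= 8 leave only
    the correlations 0 and -1, a filter applied before f is enumerated. *)
Lemma no_side4 : let S := signed in
  all (fun h => if all_lazy (fun p => if eq_nat_int 0 p then true else p == -1) (acorrs h)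
     then let hp := with_acorrs h in
       all (fun fg => if eq_nat_int 0 (dot h fg.1) then
                  ~~ all_excess in_m7_m5 hp fg.2 else true) S
     else true) (balanced 4).
Proof. by vm_compute. Qed.

Lemma no_side22 : let K := keys2 in all (fun k => all (fun k' => ~~ compatible k k') K) K.
Proof. by vm_compute. Qed.

(** One entry is 1 and one is -1, so overlaps with a nontrivial shift are negative. *)
Lemma acorrs2_le0 : all (fun h => all (fun p => p <= 0) (acorrs h)) (balanced 2).
Proof. by vm_compute. Qed.

(** Parity: the sum of the entries and that of their squares agree modulo 2. The same excludes 3. *)
Lemma balanced1 : balanced 1 = [::].
Proof. by vm_compute. Qed.

Lemma balanced3 : balanced 3 = [::].
Proof. by vm_compute. Qed.

Lemma balanced0 : balanced 0 = [:: nseq 9 0].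
Proof. by vm_compute. Qed.

Lemma all_lazyE (T : Type) (p : T -> bool) s : all_lazy p s = all p s.
Proof. by elim: s => //= x s ->. Qed.

(* from here on conversion must not evaluate these lists *)
Opaque balanced signed keys2.

Lemma mem_dedup (s : seq (seq int)) : foldr insert_new [::] s =i s.
Proof.
elim: s => //= k s IH x; rewrite inE -IH; elim: (foldr _ _ _) => //= k' K IHK.
case: eqP => [->|_]; rewrite !inE; first by rewrite orbA orbb.
by rewrite IHK orbCA.
Qed.

Lemma eq_nat_intE n x : eq_nat_int n x = (x == n%:Z).
Proof. by case: x => m //=; rewrite eqE /= -eqnE. Qed.

Lemma ge_m11E y : ge_m11 y = (-11 <= y).
Proof. by case: y => n /=; lia. Qed.

Lemma in_m7_m5E y : in_m7_m5 y = (-7 <= y <= -5).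
Proof. case: y => n /=; first lia. by case: ifP; lia. Qed.

Lemma compatible_map (I : Type) (x y : int) (u v : I -> int) (s : seq I) :
  compatible (x :: map u s) (y :: map v s) =
  (x + y == 0) && all (fun i => -7 <= u i + v i <= -5) s.
Proof.
rewrite -[LHS]/(if eq_nat_int 0 (x + y)
  then all_lazy in_m7_m5 (addseq (map u s) (map v s)) else false).
rewrite eq_nat_intE all_lazyE; case: eqP => // _ /=.
by elim: s => //= i s ->; rewrite in_m7_m5E.
Qed.

Lemma dot_cons x y u v : dot (x :: u) (y :: v) = x * y + dot u v.
Proof. by case: x => [[|n]|n] //; rewrite mul0r add0r. Qed.

Lemma mem_signs s : (forall x, x \in s -> is_sign x) -> s \in signs (size s).
Proof.
elim: s => // x s IH xs /=; have {}IH : s \in signs (size s).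
  by apply: IH => y ys; apply: xs; rewrite inE ys orbT.
rewrite mem_cat; have [->|->] := xs x (mem_head _ _); apply/orP; [left|right]; exact: map_f.
Qed.

Lemma dot_ge0 s : 0 <= dot s s.
Proof. by elim: s => // x s IH; rewrite dot_cons; nia. Qed.

Lemma mem_ternary s (b : nat) : (forall x, x \in s -> `|x| <= 1) -> dot s s <= b%:Z ->
  s \in ternary (size s) b.
Proof.
elim: s b => // x s IH b xs; rewrite dot_cons => xb /=.
have ss := dot_ge0 s; have x1 := xs x (mem_head _ _).
have {}IH c : dot s s <= c%:Z -> s \in ternary (size s) c.
  by apply: IH => y ys; apply: xs; rewrite inE ys orbT.
rewrite mem_cat; have [x0|x0] := eqVneq x 0.
  by rewrite x0 map_f // IH; lia.
case: b xb => [|b] xb; first by exfalso; nia.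
rewrite mem_cat; have [->|->] : x = 1 \/ x = -1 by lia.
  by rewrite map_f ?orbT // IH; lia.
by rewrite (map_f (cons (-1))) ?orbT // IH; lia.
Qed.

Definition list9 (f : 'Z_9 -> int) : seq int := [seq f k%:R | k <- iota 0 9].

Lemma list9P (f : 'Z_9 -> int) (P : int -> Prop) : (forall i, P (f i)) ->
  forall x, x \in list9 f -> P x.
Proof. by move=> fP x /mapP[k _ ->]. Qed.

Lemma mem_list9 (f : 'Z_9 -> int) i : f i \in list9 f.
Proof. by apply/mapP; exists (i : nat); rewrite ?natr_Zp // mem_iota ltn_ord. Qed.

Lemma dot_list9 (f g : 'Z_9 -> int) : dot (list9 f) (list9 g) = \sum_i f i * g i.
Proof. by rewrite /list9 [map _ _]/= [X in dot _ X]/= !dot_cons sum_Z9 /= addr0 !addrA. Qed.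

Lemma addseq_list9 (f g : 'Z_9 -> int) :
  addseq (list9 f) (list9 g) = list9 (fun i => f i + g i).
Proof. by []. Qed.

Lemma rot_list9 (f : 'Z_9 -> int) s : (s < 9)%N ->
  rot s (list9 f) = list9 (fun i => f (i + s%:R)).
Proof.
by do 9![case: s => [|s]; first by move=> _; rewrite /rot /list9 /= !natr_Z9D].
Qed.

Lemma rotr_list9 (f : 'Z_9 -> int) s : (s < 9)%N ->
  rotr s (list9 f) = list9 (fun i => f (i - s%:R)).
Proof.
move=> s9; apply: (can_inj (@rotK s _)); rewrite rotrK rot_list9 //.
by apply: eq_map => k; rewrite addrK.
Qed.

Lemma dot_rot (h : 'Z_9 -> int) s : (s < 9)%N ->
  dot (list9 h) (rot s (list9 h)) = corr h s%:R.
Proof. by move=> s9; rewrite rot_list9 // dot_list9. Qed.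

Lemma dot_symshift (f h : 'Z_9 -> int) s : (s < 9)%N ->
  dot (list9 h) (addseq (rotr s (list9 f)) (rot s (list9 f))) = xcorr f h s%:R.
Proof. by move=> s9; rewrite rotr_list9 // rot_list9 // addseq_list9 dot_list9. Qed.

Lemma key_list9 (f h : 'Z_9 -> int) :
  key (with_acorrs (list9 h)) (with_symshifts (list9 f)) =
  \sum_i h i * f i :: [seq 12 * corr h s%:R + xcorr f h s%:R | s <- iota 1 4].
Proof.
rewrite /key dot_list9; congr cons.
rewrite /with_acorrs /acorrs /with_symshifts /symshifts.
rewrite -map_comp zip_map -map_comp; apply/eq_in_map => s.
rewrite mem_iota => s4; rewrite -dot_rot -?dot_symshift //; lia.
Qed.

Lemma all_excess_list9 Q (f h : 'Z_9 -> int) :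
  all_excess Q (with_acorrs (list9 h)) (with_symshifts (list9 f)).2 =
  all Q (behead (key (with_acorrs (list9 h)) (with_symshifts (list9 f)))).
Proof. by rewrite /all_excess all_lazyE; apply/esym/all_map. Qed.

Lemma acorrs_list9 (h : 'Z_9 -> int) : acorrs (list9 h) = [seq corr h s%:R | s <- iota 1 4].
Proof.
by apply/eq_in_map => s; rewrite mem_iota => s4; rewrite dot_rot //; lia.
Qed.

(** The other entries sum to -h i, so their squares sum to at least |h i|; an entry of size 2 would
    force 4 + 2 > 4. *)
Lemma norm_le1 (h : 'Z_9 -> int) i : \sum_j h j = 0 -> corr h 0 <= 4 -> `|h i| <= 1.
Proof.
have -> : corr h 0 = \sum_j h j * h j by apply: eq_bigr => j _; rewrite addr0.
rewrite (bigD1 i) //= [X in _ -> X <= _ -> _](bigD1 i) //=.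
have : `|\sum_(j | j != i) h j| <= \sum_(j | j != i) h j * h j.
  rewrite (le_trans (ler_norm_sum _ _ _)) //; apply: ler_sum => j _; nia.
move: (\sum_(j | _) h j) (\sum_(j | _) h j * h j) => S N; nia.
Qed.

Lemma mem_balanced (h : 'Z_9 -> int) (n : nat) : (n <= 4)%N -> corr h 0 = n%:Z ->
  \sum_j h j = 0 -> list9 h \in balanced n.
Proof.
move=> n4 hn h0; have hh : dot (list9 h) (list9 h) = n%:Z.
  by rewrite -hn -(@dot_rot h 0) // rot0.
rewrite mem_filter hh !eq_nat_intE eqxx (_ : nseq 9 1 = list9 (fun=> 1)) // dot_list9.
rewrite (eq_bigr h); last by move=> i _; rewrite mul1r.
rewrite h0 eqxx; apply: (@mem_ternary (list9 h) 4); last by rewrite hh.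
by apply: list9P => i; apply: norm_le1 => //; rewrite hn; lia.
Qed.

Lemma mem_signed (f : 'Z_9 -> int) : (forall i, is_sign (f i)) ->
  with_symshifts (list9 f) \in signed.
Proof. by move=> fs; apply: map_f; apply: (mem_signs (list9P fs)). Qed.

Section Order6.
Variables f h k l : 'Z_9 -> int.
Hypotheses (fs : forall i, is_sign (f i)) (ks : forall i, is_sign (k i)).
Hypotheses (h0 : \sum_i h i = 0) (l0 : \sum_i l i = 0).
Hypothesis e0 : \sum_i h i * f i + \sum_i l i * k i = 0.
Hypothesis es : forall s, (0 < s < 5)%N ->
  -7 <= 12 * corr h s%:R + xcorr f h s%:R + (12 * corr l s%:R + xcorr k l s%:R) <= -5.

Lemma no_side_4_0 : corr h 0 = 4 -> corr l 0 = 0 -> False.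
Proof.
move=> hn ln; have hB := @mem_balanced h 4 isT hn h0; have fS := mem_signed fs.
have lz i : l i = 0.
  have := @mem_balanced l 0 isT ln l0; rewrite balanced0 inE => /eqP lE.
  by have := mem_list9 l i; rewrite lE mem_nseq => /eqP.
have es' s : (0 < s < 5)%N -> -7 <= 12 * corr h s%:R + xcorr f h s%:R <= -5.
  move=> /es; rewrite [corr l _]big1; last by move=> i _; rewrite lz mul0r.
  by rewrite [xcorr k l _]big1 ?addr0 // => i _; rewrite lz mul0r.
have := allP no_side4 _ hB; cbv beta zeta; rewrite all_lazyE acorrs_list9 ifT; last first.
  apply/allP => x /mapP[s + ->]; rewrite mem_iota => s4.
  rewrite eq_nat_intE; case: eqP => // p0; apply/eqP.
  have s9 : (0 < s < 5)%N by lia.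
  have := es' s s9; have := xcorr_sign_le h s%:R fs; rewrite hn.
  by move: (corr h _) (xcorr _ _ _) p0 => P X; lia.
move=> /allP/(_ _ fS); rewrite [_.1]/= eq_nat_intE dot_list9.
have lk0 : \sum_i l i * k i = 0 by apply: big1 => i _; rewrite lz mul0r.
have hf0 : \sum_i h i * f i = 0 by move: e0; rewrite lk0 addr0.
rewrite hf0 eqxx all_excess_list9 key_list9 => /negP; apply; apply/allP => x /mapP[s + ->].
by rewrite mem_iota => s4; rewrite in_m7_m5E es' //; lia.
Qed.

Lemma no_side_2_2 : corr h 0 = 2 -> corr l 0 = 2 -> False.
Proof.
move=> hn ln.
have keyK (u v : 'Z_9 -> int) : (forall i, is_sign (u i)) -> \sum_i v i = 0 -> corr v 0 = 2 ->
    (forall s, (0 < s < 5)%N -> -11 <= 12 * corr v s%:R + xcorr u v s%:R) ->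
    key (with_acorrs (list9 v)) (with_symshifts (list9 u)) \in keys2.
  move=> us v0 vn vs; rewrite mem_dedup; apply/flatten_mapP; exists (list9 v).
    exact: (@mem_balanced v 2).
  apply: map_f; rewrite mem_filter mem_signed // andbT all_excess_list9 key_list9.
  apply/allP => x /mapP[s + ->]; rewrite mem_iota => s4.
  by rewrite ge_m11E vs //; lia.
have le4 (u v : 'Z_9 -> int) s : (forall i, is_sign (u i)) -> \sum_i v i = 0 -> corr v 0 = 2 ->
    (0 < s < 5)%N -> 12 * corr v s%:R + xcorr u v s%:R <= 4.
  move=> us v0 vn s5; have := allP acorrs2_le0 _ (@mem_balanced v 2 isT vn v0).
  have sI : s \in iota 1 4 by rewrite mem_iota; lia.
  rewrite acorrs_list9 => /allP/(_ _ (map_f (fun s => corr v s%:R) sI)).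
  have := xcorr_sign_le v s%:R us; rewrite vn.
  by move: (corr v _) (xcorr _ _ _) => P X; lia.
have kf : key (with_acorrs (list9 h)) (with_symshifts (list9 f)) \in keys2.
  by apply: (keyK f h fs h0 hn) => s s5; have := es s5; have := le4 k l s ks l0 ln s5; lia.
have kk : key (with_acorrs (list9 l)) (with_symshifts (list9 k)) \in keys2.
  apply: (keyK k l ks l0 ln) => s s5; clear kf.
  by have := es s5; have := le4 f h s fs h0 hn s5; lia.
have /negP := allP (allP no_side22 _ kf) _ kk; apply.
rewrite !key_list9 compatible_map e0 eqxx; apply/allP => s.
by rewrite mem_iota => s4; apply: es; lia.
Qed.

End Order6.

Lemma no_compress9_12 (f h k l : 'Z_9 -> int) :
  (forall i, is_sign (f i)) -> (forall i, is_sign (k i)) ->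
  (forall s, corr (fun i => f i + 12 * h i) s + corr (fun i => k i + 12 * l i) s
             = if s == 0 then 594 else -74) -> False.
Proof.
move=> fs ks /compress9_expand[] // h0 l0 e0 es.
have ge0 (u : 'Z_9 -> int) : 0 <= corr u 0.
  by apply: sumr_ge0 => j _; rewrite addr0 -expr2 sqr_ge0.
(* With N this sum and X the sum of the [xcorr] at 0: X = 48 - 12 N and |X| <= 2 N force N = 4. *)
have N4 : corr h 0 + corr l 0 = 4.
  by have := xcorr_sign_le h 0 fs; have := xcorr_sign_le l 0 ks; lia.
have xE (u v : 'Z_9 -> int) : xcorr u v 0 = 2 * \sum_i v i * u i.
  by rewrite /xcorr mulr_sumr; apply: eq_bigr => i _; rewrite subr0 addr0; ring.
have {}e0 : \sum_i h i * f i + \sum_i l i * k i = 0 by move: e0; rewrite !xE; lia.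
(* 12 times the middle term is -74 - q with |q| <= 18, hence between -92 and -56. *)
have {}es s : (0 < s < 5)%N ->
    -7 <= 12 * corr h s%:R + xcorr f h s%:R + (12 * corr l s%:R + xcorr k l s%:R) <= -5.
  move=> s5; have [|q q18] := es s%:R; last by lia.
  by rewrite -val_eqE /= val_Zp_nat // modn_small; lia.
have [n hn] : exists n : nat, corr h 0 = n%:Z by exists (absz (corr h 0)); rewrite gez0_abs.
have {N4} ln : corr l 0 = 4 - n%:Z by rewrite -N4 hn addrC addKr.
have n4 : (n <= 4)%N by have := ge0 l; rewrite ln; lia.
case: n n4 hn ln => [|[|[|[|[|//]]]]] _ hn ln.
- by apply: (@no_side_4_0 k l f h) => //; [rewrite addrC | move=> s s5; rewrite addrC es].
- by have := @mem_balanced h 1 isT hn h0; rewrite balanced1 in_nil.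
- exact: (@no_side_2_2 f h k l).
- by have := @mem_balanced h 3 isT hn h0; rewrite balanced3 in_nil.
- exact: (@no_side_4_0 f h k l).
Qed.

Lemma no_legendre_1_27 y z : legendre2 y z ->
  (forall i g, y i (27%:R * g) = y i g) ->
  (forall i g, z i (27%:R * g) = z i g) -> False.
Proof.
move=> yz y27 z27; have ys := sign_l yz; have zs := sign_r yz.
have [|f [h [fs fE]]] := @compress9_split 12 y ys.
  by move=> i; apply: (sum_Z37_27 (ys i) (y27 i)).
have [|k [l [ks kE]]] := @compress9_split 12 z zs.
  by move=> i; apply: (sum_Z37_27 (zs i) (z27 i)).
by apply: (@no_compress9_12 f h k l) => // s; rewrite -fE -kE (corr_compress9 yz).
Qed.

(** * Invariance by (1,6): Fourier analysis in characteristic 167 *)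

(** Primitivity of the root of unity is expressed by its being a root of 1 + X + ... + X^36. *)
Lemma prim_root37_char167 : exists (K : fieldType) (z : K),
  [/\ (167 \in [pchar K])%N, z ^+ 37 = 1 & \sum_(i < 37) z ^+ i = 0].
Proof.
have [K [iota _]] := countable_algebraic_closure 'F_167.
have /closed_rootP[z] : size (\poly_(i < 37) (1 : K)) != 1%N by rewrite size_poly_eq ?oner_eq0.
rewrite rootE horner_poly => /eqP z0.
have {}z0 : \sum_(i < 37) z ^+ i = 0.
  by rewrite -[RHS]z0; apply: eq_bigr => i _; rewrite mul1r.
exists K, z; split=> //.
- by rewrite (fmorph_pchar iota) pchar_Fp.
- by apply/eqP; rewrite -subr_eq0 subrX1 z0 mulr0.
Qed.

Section Fourier.
(** The prime is 167 in the application; it enters through 668 = 4 * 167 and its residues modulo 37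
    and 4. *)
Variables (p : nat) (K : fieldType) (z : K).
Hypothesis charp : (p \in [pchar K])%N.
Hypotheses (p_gt37 : (37 < p)%N) (p_dvd : (p %| 668)%N).
Hypotheses (p37 : p = 19 %[mod 37]) (p4 : p = 3 %[mod 4]).
Hypothesis z37 : z ^+ 37 = 1.
Hypothesis sum_z : \sum_(i < 37) z ^+ i = 0.

Definition chi (g : 'Z_37) : K := z ^+ g.

Lemma chiD g h : chi (g + h) = chi g * chi h.
Proof. by rewrite /chi -exprD -(expr_mod (g + h) z37). Qed.

Lemma chi0 : chi 0 = 1. Proof. exact: expr0. Qed.

Lemma sum_chi : \sum_g chi g = 0. Proof. exact: sum_z. Qed.

Lemma chiM n g : chi (n%:R * g) = chi g ^+ n.
Proof.
rewrite mulr_natl.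
elim: n => [|n IH].
  rewrite mulr0n. rewrite expr0. exact: chi0.
rewrite mulrS. rewrite chiD. rewrite IH. rewrite exprS. reflexivity.
Qed.

Let nat_dvd37 : (2 : K) != 0 /\ (37 : K) != 0.
Proof. by split; rewrite -(dvdn_pcharf charp) gtnNdvd // (ltn_trans _ p_gt37). Qed.

Let inj_small (x : int) : `|x| <= 37 -> x%:~R = 0 :> K -> x = 0.
Proof.
case: x => n; [rewrite -pmulrn|rewrite NegzE mulrNz -pmulrn] => nlt /eqP; last rewrite oppr_eq0.
all: rewrite -(dvdn_pcharf charp) => dvdn; have := dvdn_leq _ dvdn; lia.
Qed.

Lemma Z37_mulI (k : 'Z_37) : k != 0 -> injective ( *%R k).
Proof.
move=> k0; apply: mulrI.
have co : coprime 37 k.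
  rewrite (prime_coprime _ (isT : prime 37)).
  have k1 : (0 < k)%N by rewrite lt0n.
  by rewrite (gtnNdvd k1 (ltn_ord k)).
by have := unitZpE k (isT : (1 < 37)%N); rewrite natr_Zp => ->.
Qed.

Lemma sum_chiM k : k != 0 -> \sum_t chi (k * t) = 0.
Proof. by move=> k0; rewrite -[RHS]sum_chi [RHS](reindex_inj (Z37_mulI k0)). Qed.

Section Sequence.
Variable d : 'Z_37 -> int.
Hypothesis d6 : forall g, d (6%:R * g) = d g.

Definition dft (k : 'Z_37) : K := \sum_g (d g)%:~R * chi (k * g).

Lemma dft6 k : dft (6%:R * k) = dft k.
Proof.
rewrite /dft [RHS](reindex_inj (@Z37_mulI 6%:R isT)) /=.
apply: eq_bigr => g _; rewrite d6; congr (_ * chi _). by rewrite -mulrA mulrCA.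
Qed.

(** -1 = 6^2 modulo 37. *)
Lemma dftN k : dft (- k) = dft k.
Proof.
rewrite -[RHS]dft6 -[RHS]dft6 mulrA -[LHS]/(dft (- k)) -mulN1r; congr (dft (_ * _)); exact/eqP.
Qed.

(** Evenness of [dft] takes the place of complex conjugation: the square is the power spectrum, the
    transform of the autocorrelation. *)
Lemma dft_norm k : dft k * dft k = \sum_t (corr d t)%:~R * chi (k * t).
Proof.
rewrite -{2}dftN /dft mulr_sumr.
under eq_bigr => h _ do rewrite mulr_suml (reindex_inj (addrI h)) /=.
rewrite exchange_big /=; apply: eq_bigr => t _.
rewrite /corr rmorph_sum mulr_suml; apply: eq_bigr => h _.
rewrite mulrACA -rmorphM -chiD /=; congr (_%:~R * chi _); ring.
Qed.

(** The n-th power is additive, fixes integers and turns chi(g) into chi(6 g), so it sends [dft k]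
    to [dft (6 k)], which is [dft k]. *)
Lemma dft_pow n : [pchar K].-nat n -> n = 6 %[mod 37] ->
  (forall x : int, x%:~R ^+ n = x%:~R :> K) -> forall k, dft k ^+ n = dft k.
Proof.
move=> nK n6 nZ k.
have sumX (F : 'Z_37 -> K) : (\sum_g F g) ^+ n = \sum_g F g ^+ n.
  apply: (big_morph (fun x : K => x ^+ n)) => [x y|]; first exact: exprDn_pchar.
  by rewrite expr0n; case: n nK {n6 nZ}.
rewrite -[RHS]dft6 /dft sumX; apply: eq_bigr => g _.
rewrite exprMn nZ -mulrA chiM; congr (_ * _).
have chi37 : chi (k * g) ^+ 37 = 1 by rewrite /chi -exprM mulnC exprM z37 expr1n.
by rewrite -(expr_mod n chi37) n6.
Qed.

(** By Fourier inversion 37 d is constant in K; differences of values of d are at most 18, so their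
    vanishing in K lifts to the integers. *)
Lemma dft_const : (forall k, k != 0 -> dft k = 0) -> (forall g, `|d g| <= 9) -> forall g, d g = d 0.
Proof.
move=> dk d9.
have inv j : \sum_k dft k * chi (- (k * j)) = 37%:R * (d j)%:~R.
  rewrite /dft; under eq_bigr => k _ do rewrite mulr_suml.
  rewrite exchange_big (bigD1 j isT) /= [X in _ + X]big1.
    rewrite addr0 (eq_bigr (fun=> (d j)%:~R)); first by rewrite sumr_const card_ord mulr_natl.
    by move=> k _; rewrite -mulrA -chiD subrr mulr1.
  move=> g gj; rewrite (eq_bigr (fun k => (d g)%:~R * chi ((g - j) * k))).
    have gj0 : g - j != 0 by rewrite subr_eq0.
    by rewrite -mulr_sumr (sum_chiM gj0) mulr0.
  by move=> k _; rewrite -mulrA -chiD; congr (_ * chi _); ring.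
have inv0 j : 37%:R * (d j)%:~R = dft 0.
  rewrite -inv (bigD1 0 isT) /= mul0r oppr0 chi0 mulr1 big1; first by rewrite addr0.
  by move=> k k0; rewrite (dk k k0) mul0r.
move=> g; apply/eqP; rewrite -subr_eq0; apply/eqP; apply: inj_small.
  by have := d9 g; have := d9 0; lia.
by rewrite rmorphB /=; apply: (mulfI (proj2 nat_dvd37)); rewrite mulrBr !inv0 subrr mulr0.
Qed.

End Sequence.

(** -1 is not a square among the solutions of u^n = u: here n - 1 is twice an odd number e, nonzero
    u satisfy (u^2)^e = 1, and x^2 = -y^2 raised to e reads 1 = -1. *)
Lemma sum_sqr_eq0 n (x y : K) : n = 3 %[mod 4] -> x ^+ n = x -> y ^+ n = y ->
  x * x + y * y = 0 -> x = 0.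
Proof.
move=> n3 xn yn /eqP; rewrite addr_eq0 -!expr2 => /eqP xy.
have nE : n = ((n %/ 4).*2.+1.*2).+1 by have := divn_eq n 4; rewrite n3 /=; lia.
have unit_pow (u : K) : u ^+ n = u -> u != 0 -> (u ^+ 2) ^+ (n %/ 4).*2.+1 = 1.
  rewrite nE exprS -[u in RHS]mulr1 => un u0; have := mulfI u0 un.
  by rewrite -exprM mul2n -nE.
have [//|x0] := eqVneq x 0; have [y0|y0] := eqVneq y 0.
  by have /eqP := xy; rewrite y0 expr0n oppr0 expf_eq0 (negPf x0).
have := unit_pow x xn x0; rewrite xy exprNn (unit_pow y yn y0) mulr1.
rewrite -signr_odd oddS odd_double expr1 => /eqP; rewrite eq_sym -subr_eq0 opprK.
by rewrite -mulr2n (negPf (proj1 nat_dvd37)).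
Qed.

(** The witness is p^9, reached by cubing twice: modulo 37, 19^3 = 14 and 14^3 = 6. *)
Lemma frobenius_pow9 : exists n, [/\ [pchar K].-nat n, n = 6 %[mod 37],
  n = 3 %[mod 4] & forall x : int, x%:~R ^+ n = x%:~R :> K].
Proof.
have cube_id q : (forall x : int, x%:~R ^+ q = x%:~R :> K) ->
    forall x : int, x%:~R ^+ (q ^ 3) = x%:~R :> K.
  by move=> F x; rewrite !expnS expn0 muln1 !exprM !F.
have p37' : p ^ 3 = 14 %[mod 37] by rewrite -modnXm p37.
have p4' : p ^ 3 = 3 %[mod 4] by rewrite -modnXm p4.
exists ((p ^ 3) ^ 3)%N; split.
- by rewrite !pnatX (pnatE _ (pcharf_prime charp)) charp.
- by rewrite -modnXm p37'.
- by rewrite -modnXm p4'.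
- by apply/cube_id/cube_id => x; rewrite -(pFrobenius_autE charp) rmorph_int.
Qed.

Lemma corr37_const (d e : 'Z_37 -> int) :
  (forall g, d (6%:R * g) = d g) -> (forall g, e (6%:R * g) = e g) ->
  (forall g, `|d g| <= 9) -> (forall t, corr d t + corr e t = if t == 0 then 650 else -18) ->
  forall g, d g = d 0.
Proof.
move=> d6 e6 d9 de; have [n [nK n37 n4 nZ]] := frobenius_pow9.
apply: (dft_const _ d9) => k k0.
apply: (@sum_sqr_eq0 n _ (dft e k) n4); [exact: dft_pow | exact: dft_pow |].
rewrite (dft_norm d6) (dft_norm e6) -big_split /=.
(* As 650 = 668 - 18, the summed correlation is 668 at 0 minus a constant; the transform of the
   constant vanishes at k != 0, and 668 = 0 in K. *)
rewrite (eq_bigr (fun t => 668%:R * (t == 0)%:R - 18%:R * chi (k * t))).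
  rewrite sumrB -!mulr_sumr (sum_chiM k0) mulr0 subr0.
  rewrite (_ : 668%:R = 0 :> K) ?mul0r //.
  by apply/eqP; rewrite -(dvdn_pcharf charp).
move=> t _; rewrite -mulrDl -rmorphD /= de; case: eqP => [->|_].
  by rewrite mulr0 chi0 !mulr1 -natrB.
by rewrite mulr0 sub0r rmorphN mulNr.
Qed.

End Fourier.

Lemma no_legendre_1_6 y z : legendre2 y z ->
  (forall i g, y i (6%:R * g) = y i g) ->
  (forall i g, z i (6%:R * g) = z i g) -> False.
Proof.
move=> yz y6 z6; have [K [zeta [charK z37 sum_z]]] := prim_root37_char167.
have le9 x : (forall i g, is_sign (x i g)) -> forall g, `|compress37 x g| <= 9.
  by move=> xs g; apply: (@sum_sign_le (x^~ g)).
have inv x : (forall i g, x i (6%:R * g) = x i g) ->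
    forall g, compress37 x (6%:R * g) = compress37 x g.
  by move=> x6 g; apply: eq_bigr => i _; rewrite x6.
have E := corr_compress37 yz.
have yc := corr37_const charK isT isT erefl erefl z37 sum_z (inv _ y6) (inv _ z6) (le9 _ (sign_l yz)) E.
have E' t : corr (compress37 z) t + corr (compress37 y) t = if t == 0 then 650 else -18.
  by rewrite addrC E.
have zc := corr37_const charK isT isT erefl erefl z37 sum_z (inv _ z6) (inv _ y6)
             (le9 _ (sign_r yz)) E'.
(* Constant sequences have nonnegative correlations, but these two add up to -18. *)
have : 0 <= corr (compress37 y) 1 + corr (compress37 z) 1; last by rewrite E.
apply: addr_ge0; apply: sumr_ge0 => g _.
  by rewrite yc [X in _ * X]yc -expr2 sqr_ge0.
by rewrite zc [X in _ * X]zc -expr2 sqr_ge0.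
Qed.

(** * The subgroups of U1 *)

(* The pair (i, j) encodes the element 112^i * 298^j, with residues (4^i, 2^j)
   modulo (9, 37), of U1, which is isomorphic to C_3 x C_36. *)
Definition codes : seq (nat * nat) := [seq (i, j) | i <- iota 0 3, j <- iota 0 36].
Definition cadd (c d : nat * nat) := ((c.1 + d.1) %% 3, (c.2 + d.2) %% 36)%N.
Definition cmuln (n : nat) (c : nat * nat) := ((n * c.1) %% 3, (n * c.2) %% 36)%N.
Definition cmultiples (c : nat * nat) := [seq cmuln n c | n <- iota 0 36].

(* One generator of every nontrivial cyclic subgroup of prime power order: a
   subgroup is determined by the elements of this list that it contains. *)
Definition primary : seq (nat * nat) :=
  [:: (0, 18); (0, 9); (0, 12); (1, 0); (1, 12); (1, 24); (0, 4); (1, 4); (2, 4)]%N.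

Definition primary_in (c : nat * nat) : bitseq :=
  let m := cmultiples c in [seq x \in m | x <- primary].
Definition bit_leq (u v : bitseq) : bool := all2 implb u v.

Fixpoint bitseqs n : seq bitseq :=
  if n is n'.+1 then map (cons true) (bitseqs n') ++ map (cons false) (bitseqs n')
  else [:: [::]].

Definition cclosed (C : seq (nat * nat)) : bool :=
  all_lazy (fun c => all_lazy (fun d => cadd c d \in C) C) C.

(** A candidate is a bit vector over [primary] that agrees with the primary elements of the set it
    defines; closure under addition is then tested. *)
Definition code_subgroups_def : seq (seq (nat * nat)) :=
  let tab := [seq (c, primary_in c) | c <- codes] in
  let ptab := [seq primary_in x | x <- primary] in
  [seq C <- [seq [seq c.1 | c <- tab & bit_leq c.2 b]
            | b <- bitseqs 9 & [seq bit_leq p b | p <- ptab] == b] | cclosed C].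

(* locked to keep conversion from evaluating the list *)
Definition code_subgroups := locked code_subgroups_def.

Definition nine_gens : seq (seq (nat * nat)) :=
  [:: [::]; [:: (0, 18)]; [:: (1, 0)]; [:: (0, 24)]; [:: (1, 24)]; [:: (1, 12)];
      [:: (0, 18); (1, 0)]; [:: (0, 18); (1, 30)]; [:: (0, 18); (1, 24)]]%N.

(** Multiples 0 to 5 are enough, the generators in [nine_gens] having orders dividing 6. *)
Definition cspan (X : seq (nat * nat)) :=
  foldr (fun x L => [seq cadd (cmuln n x) c | n <- iota 0 6, c <- L]) [:: (0, 0)%N] X.

Definition code_group (X : seq (nat * nat)) := [seq c <- codes | c \in cspan X].

Definition nine_codes := [seq code_group X | X <- nine_gens].

(** In order, the residue pairs (4,1), (4,16), (7,16), (1,16), (1,27), (1,6). *)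
Definition obstructed_codes : seq (nat * nat) := [:: (1, 0); (1, 4); (2, 4); (0, 4); (0, 6); (0, 27)]%N.

Definition code_conditions (S : seq (seq (nat * nat))) : bool :=
  [&& uniq S, all (fun C => (0, 0)%N \in C) S, size S == 30%N, all (mem S) nine_codes,
      count (fun C => C \notin nine_codes) S == 21%N,
      count (fun C : seq _ => 9 <= size C)%N S == 19%N
    & all (fun C => (C \in nine_codes) || has (mem C) obstructed_codes) S].

Lemma code_checks_def : code_conditions code_subgroups_def.
Proof. by vm_compute. Qed.

Lemma code_checks : code_conditions code_subgroups.
Proof. by rewrite /code_subgroups -lock; apply: code_checks_def. Qed.

Lemma nine_checks :
  [&& uniq nine_codes, map size nine_codes == [:: 1; 2; 3; 3; 3; 3; 6; 6; 6]%N
    & all (fun X => all (mem codes) X && all (mem (cspan X)) X) nine_gens].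
Proof. by vm_compute. Qed.

(* the components of c = 9c + 28c of order prime to 3 and to 2 are multiples of
   elements of primary that are themselves multiples of c *)
Lemma primary_check : all (fun c => let m := cmultiples c in
  (cadd (cmuln 9 c) (cmuln 28 c) == c) &&
  all (fun d => (d == (0, 0)%N) || has (fun x => (x \in m) && (d \in cmultiples x)) primary)
   [:: cmuln 9 c; cmuln 28 c]) codes.
Proof. by vm_compute. Qed.

Lemma primary_codes : all (mem codes) primary.
Proof. by vm_compute. Qed.

(** * From codes to units and subgroups *)

Notation unit333 := {unit 'Z_333}.

Definition res (u : unit333) := crt (FinRing.uval u).

Lemma res_inj : injective res.
Proof. by move=> u v /(bij_inj crt_bij) /val_inj. Qed.

Lemma resM u v : res (u * v)%g = ((res u).1 * (res v).1, (res u).2 * (res v).2).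
Proof. exact: crtM. Qed.

Lemma res1 : res 1%g = (1, 1).
Proof. by []. Qed.

Lemma resX u n : res (u ^+ n)%g = ((res u).1 ^+ n, (res u).2 ^+ n).
Proof. by elim: n => [|n IH]; rewrite ?expg0 // expgS resM IH !exprS. Qed.

Definition decode (c : nat * nat) : unit333 := (res333 112 ^+ c.1 * res333 298 ^+ c.2)%g.

Lemma natr_crt n : crt n%:R = (n%:R, n%:R).
Proof. by congr pair; apply: val_inj; rewrite /= !val_Zp_nat // modn_dvdm. Qed.

Lemma res_decode c : res (decode c) = (4%:R ^+ c.1, 2%:R ^+ c.2).
Proof.
rewrite resM !resX; rewrite /res !natr_crt /=.
rewrite (_ : 112%:R = 4%:R); last exact/eqP.
rewrite (_ : 298%:R = 1); last exact/eqP.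
rewrite (_ : (112%:R : 'Z_37) = 1); last exact/eqP.
rewrite (_ : 298%:R = 2%:R); last exact/eqP.
by rewrite !expr1n mul1r mulr1.
Qed.

Lemma decodeD c d : decode (cadd c d) = (decode c * decode d)%g.
Proof.
apply: res_inj; rewrite resM !res_decode -!exprD /=.
congr pair; apply: expr_mod; exact/eqP.
Qed.

Lemma decode_muln n c : decode (cmuln n c) = (decode c ^+ n)%g.
Proof.
apply: res_inj; rewrite resX !res_decode -!exprM !(mulnC _ n) /=.
congr pair; apply: expr_mod; exact/eqP.
Qed.

Lemma decode0 : decode (0, 0)%N = 1%g.
Proof. by rewrite /decode !expg0 mulg1. Qed.

Lemma uniq_map_inj (T U : eqType) (f : T -> U) (s : seq T) :
  uniq (map f s) -> {in s &, injective f}.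
Proof.
move=> us x y xs ys fxy; rewrite -(nth_index x xs) -(nth_index x ys).
congr nth; apply/eqP; rewrite -(nth_uniq (f x) _ _ us) ?size_map ?index_mem //.
by rewrite !(nth_map x) ?index_mem // !nth_index ?fxy.
Qed.

Lemma mem_codes c : (c \in codes) = (c.1 < 3)%N && (c.2 < 36)%N.
Proof.
case: c => i j; apply/allpairsP/andP => [[[i' j'] []]|[i3 j36]].
  by rewrite !mem_iota /= => i3 j36 [-> ->].
by exists (i, j); rewrite !mem_iota.
Qed.

Lemma decode_inj : {in codes &, injective decode}.
Proof.
case=> [i j] [i' j']; rewrite !mem_codes => /andP[/= i3 j36] /andP[/= i3' j36'].
move=> /(congr1 res); rewrite !res_decode => -[e4 e2].
have u4 : uniq [seq (4%:R : 'Z_9) ^+ i | i <- iota 0 3] by vm_compute.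
have u2 : uniq [seq (2%:R : 'Z_37) ^+ j | j <- iota 0 36] by vm_compute.
by congr pair; [apply: (uniq_map_inj u4) | apply: (uniq_map_inj u2)]; rewrite ?mem_iota.
Qed.

Lemma decode_U1 c : decode c \in U1.
Proof.
have U (n : nat) (co : coprime 333 n) : n = 1 %[mod 3] -> @Zunit 333 n isT co \in U1.
  by move=> n1; rewrite inE /= val_Zp_nat // modn_dvdm // n1.
by apply: groupM; apply: groupX; apply: U.
Qed.

Lemma U1_decode u : u \in U1 -> exists2 c, c \in codes & u = decode c.
Proof.
rewrite inE => /eqP u1.
have [j j36 uj] : exists2 j, (j < 36)%N & (res u).2 = 2%:R ^+ j.
  have := mem_Z37_pow2 (res u).2; rewrite inE => /orP[/eqP u0|/mapP[j]]; last first.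
    by rewrite mem_iota => j36 uj; exists j.
  have := valP u; rewrite /= -[FinRing.uval u]natr_Zp unitZpE // => co.
  have : coprime 37 (FinRing.uval u) by apply: coprime_dvdl co.
  rewrite (prime_coprime _ (isT : prime 37)) /dvdn.
  by have /(congr1 val) /= -> := u0.
have [i i3 ui] : exists2 i, (i < 3)%N & (res u).1 = 4%:R ^+ i.
  have : ((res u).1 %% 3 = 1)%N by rewrite /= modn_dvdm.
  move: (res u).1 => a a1.
  have [e|[e|e]] : (a : nat) = 1%N \/ (a : nat) = 4 \/ (a : nat) = 7.
    have a9 : (a < 9)%N := ltn_ord a.
    by move: (nat_of_ord a) a1 a9 => n; lia.
  - by exists 0%N => //; apply: val_inj; rewrite /= e.
  - by exists 1%N => //; apply: val_inj; rewrite /= e.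
  - by exists 2%N => //; apply: val_inj; rewrite /= e.
exists (i, j); first by rewrite mem_codes i3.
by apply: res_inj; rewrite res_decode -ui -uj; case: (res u).
Qed.

Definition decode_group (C : seq (nat * nat)) : {group unit333} :=
  <<[set u in map decode C]>>%G.

Lemma filter_tabulated (T U : Type) (f : T -> U) (p : pred U) (s : seq T) :
  [seq c.1 | c <- [seq (c, f c) | c <- s] & p c.2] = [seq c <- s | p (f c)].
Proof. by elim: s => //= c s <-; case: ifP. Qed.

Definition code_span (b : bitseq) := [seq c <- codes | bit_leq (primary_in c) b].

Lemma uniq_codes : uniq codes.
Proof. by vm_compute. Qed.

Lemma cclosedP C : cclosed C -> forall c d, c \in C -> d \in C -> cadd c d \in C.
Proof.
rewrite /cclosed all_lazyE => /allP H c d cC dC.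
by move: (H c cC); rewrite all_lazyE => /allP/(_ d dC).
Qed.

Lemma code_subgroups_span C : C \in code_subgroups ->
  cclosed C /\ exists b, C = code_span b.
Proof.
rewrite /code_subgroups -lock mem_filter => /andP[clC /mapP[b _ CE]].
split; first exact: clC.
by exists b; rewrite {clC}CE; apply: (filter_tabulated primary_in (bit_leq^~ b)).
Qed.

Lemma code_subgroupsP C : C \in code_subgroups ->
  [/\ uniq C, {subset C <= codes} & forall c d, c \in C -> d \in C -> cadd c d \in C].
Proof.
move=> /code_subgroups_span[clC [b CE]]; split; last exact: cclosedP clC.
- by rewrite CE; apply: filter_uniq uniq_codes.
- by move=> c; rewrite CE mem_filter => /andP[].
Qed.

Lemma decode_groupE C : C \in code_subgroups ->
  gval (decode_group C) = [set u in map decode C].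
Proof.
move=> CS; have [_ _ CD] := code_subgroupsP CS.
have C0 : (0, 0)%N \in C by have /and3P[_ /allP/(_ C CS)] := code_checks.
have gC : group_set [set u in map decode C].
  apply/group_setP; split; first by rewrite inE -decode0 map_f.
  move=> u v; rewrite !inE => /mapP[c cC ->] /mapP[d dC ->].
  by rewrite -decodeD map_f // CD.
by rewrite /= (gen_set_id gC).
Qed.

(** H is recovered from the bit vector [b] of the primary elements it contains, so it is among the
    enumerated candidates. *)
Lemma subgroup_decode (H : {group unit333}) : H \subset U1 ->
  exists2 C, C \in code_subgroups & H = decode_group C.
Proof.
move=> /subsetP HU; pose b := [seq decode x \in H | x <- primary].
have inHX c x : x \in cmultiples c -> decode c \in H -> decode x \in H.
  by case/mapP=> n _ ->; rewrite decode_muln; apply: groupX.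
have inH c : c \in codes -> (decode c \in H) = bit_leq (primary_in c) b.
  move=> cc; rewrite /bit_leq all2E !size_map eqxx zip_map all_map.
  apply/idP/allP => [cH x _|cb]; first by apply/implyP => /= xc; apply: inHX xc cH.
  have /andP[/eqP cE /allP d0x] := allP primary_check c cc.
  have inH d : d \in [:: cmuln 9 c; cmuln 28 c] -> decode d \in H.
    move=> /d0x/orP[/eqP->|/hasP[x xp /andP[xc dx]]]; first by rewrite decode0 group1.
    by apply: inHX dx _; apply: implyP (cb x xp) xc.
  by rewrite -cE decodeD groupM // inH // !inE eqxx ?orbT.
have bE : [seq bit_leq p b | p <- [seq primary_in x | x <- primary]] == b.
  apply/eqP; rewrite -map_comp; apply/eq_in_map => x xp.
  exact: esym (inH x (allP primary_codes x xp)).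
have bB : b \in bitseqs 9.
  have mem_bitseqs (v : bitseq) : v \in bitseqs (size v).
    elim: v => // x v IH; rewrite /= mem_cat.
    by case: x; rewrite map_f ?orbT.
  exact: (mem_bitseqs b).
(* The existential hides the body of [C] from conversion. *)
have [C CE] : exists C, C = code_span b by exists (code_span b).
have CH c : c \in codes -> (c \in C) = (decode c \in H).
  by move=> cc; rewrite CE mem_filter cc andbT inH.
have Cc c : c \in C -> c \in codes by rewrite CE mem_filter => /andP[].
have CS : C \in code_subgroups.
  rewrite /code_subgroups -lock mem_filter; apply/andP; split.
    rewrite /cclosed all_lazyE; apply/allP => c cC; rewrite all_lazyE; apply/allP => d dC.
    have caddP : cadd c d \in codes by rewrite mem_codes !ltn_mod.
    by rewrite CH // decodeD groupM -?CH //; apply: Cc.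
  apply/mapP; exists b; first by rewrite mem_filter bE.
  rewrite CE; exact: esym (filter_tabulated primary_in (bit_leq^~ b) codes).
exists C; first exact: CS.
apply: group_inj; rewrite (decode_groupE CS); apply/setP => u; rewrite inE.
apply/idP/mapP => [uH|[c cC ->]].
  by have [c cc uc] := U1_decode (HU u uH); exists c; rewrite ?CH -?uc.
by rewrite -CH // Cc.
Qed.

Lemma mem_decode_group C c : C \in code_subgroups -> c \in codes ->
  (decode c \in decode_group C) = (c \in C).
Proof.
move=> CS cc; have [_ Ccodes _] := code_subgroupsP CS.
have -> : (decode c \in decode_group C) = (decode c \in [set u in map decode C]).
  by rewrite -(decode_groupE CS).
rewrite inE; apply/mapP/idP => [[d dC /decode_inj->]|cC] //; last by exists c.
exact: Ccodes.
Qed.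

(** Each list is the sublist of [codes], in its fixed order, selected by membership in the group, so
    equal groups give equal lists. *)
Lemma decode_group_inj : {in code_subgroups &, injective decode_group}.
Proof.
move=> C D CS DS CD; have filterE E : E \in code_subgroups -> E = [seq c <- codes | decode c \in decode_group E].
  move=> ES; have [_ [b EE]] := code_subgroups_span ES.
  rewrite [LHS]EE; apply: eq_in_filter => c cc; rewrite mem_decode_group // EE mem_filter cc andbT //.
by rewrite (filterE C CS) CD -(filterE D DS).
Qed.

Lemma card_decode_group C : C \in code_subgroups -> #|decode_group C| = size C.
Proof.
move=> CS; have [uC Ccodes _] := code_subgroupsP CS.
have -> : #|decode_group C| = #|[set u in map decode C]| by rewrite -(decode_groupE CS).
rewrite cardsE -(size_map decode); apply/card_uniqP.
by rewrite map_inj_in_uniq // => c d /Ccodes cc /Ccodes dc; apply: decode_inj.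
Qed.

Lemma mem_subgroups H : (H \in subgroups U1) = (H \in map decode_group code_subgroups).
Proof.
rewrite inE; apply/idP/mapP => [/subgroup_decode[C CS ->]|[C CS ->]]; first by exists C.
by rewrite (decode_groupE CS); apply/subsetP => u; rewrite inE => /mapP[c _ ->]; apply: decode_U1.
Qed.

Lemma card_subgroups_count (P : pred {group unit333}) :
  #|[set H in subgroups U1 | P H]| = count (P \o decode_group) code_subgroups.
Proof.
have /andP[uS _] := code_checks.
rewrite -size_filter -(size_map decode_group) -filter_map.
rewrite (eq_card (B := mem (filter P (map decode_group code_subgroups)))).
  by apply/card_uniqP; rewrite filter_uniq // (map_inj_in_uniq decode_group_inj).
by move=> H; rewrite inE mem_filter mem_subgroups andbC.
Qed.

Lemma decode_res c n (co : coprime 333 n) :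
  4%:R ^+ c.1 == n%:R :> 'Z_9 -> 2%:R ^+ c.2 == n%:R :> 'Z_37 ->
  @Zunit 333 n isT co = decode c.
Proof.
by move=> /eqP e9 /eqP e37; apply: res_inj; rewrite res_decode e9 e37 -natr_crt.
Qed.

Lemma decode_cspan (H : {group unit333}) X : {in X, forall x, decode x \in H} ->
  {in cspan X, forall c, decode c \in H}.
Proof.
elim: X => [|x X IH] XH c; first by rewrite inE => /eqP->; rewrite decode0.
case/allpairsP=> -[n d] [_ /= dX ->]; rewrite decodeD decode_muln groupM //.
  by rewrite groupX // XH // mem_head.
by apply: IH dX => y yX; rewrite XH // inE yX orbT.
Qed.

Lemma gen_decode X : X \in nine_gens ->
  <<[set u in map decode X]>>%g = decode_group (code_group X).
Proof.
move=> XN; have CS : code_group X \in code_subgroups.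
  have /and5P[_ _ _ /allP nS _] := code_checks.
  exact: nS _ (map_f code_group XN).
have /and3P[_ _ /allP/(_ X XN)/andP[/allP Xc /allP Xs]] := nine_checks.
apply/eqP; rewrite eqEsubset gen_subG (decode_groupE CS); apply/andP; split; apply/subsetP => u.
  rewrite !inE => /mapP[x xX ->]; apply: map_f; rewrite mem_filter.
  by apply/andP; split; [apply: Xs | apply: Xc].
rewrite inE => /mapP[c cC ->].
apply: (@decode_cspan <<_>>%G X); last by move: cC; rewrite mem_filter => /andP[].
by move=> x xX; rewrite mem_gen // inE map_f.
Qed.

Lemma nine_subgroupsE : nine_subgroups = map decode_group nine_codes.
Proof.
have E1 c n (co : coprime 333 n) : [:: c] \in nine_gens ->
    @Zunit 333 n isT co = decode c -> <[@Zunit 333 n isT co]>%G = decode_group (code_group [:: c]).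
  move=> cN ->; apply: group_inj; rewrite -(gen_decode cN) /=.
  by congr (<<_>>)%g; apply/setP => u; rewrite !inE.
have E2 c d m n (cm : coprime 333 m) (cn : coprime 333 n) : [:: c; d] \in nine_gens ->
    @Zunit 333 m isT cm = decode c -> @Zunit 333 n isT cn = decode d ->
    <<[set @Zunit 333 m isT cm; @Zunit 333 n isT cn]>>%G = decode_group (code_group [:: c; d]).
  move=> cN -> ->; apply: group_inj; rewrite -(gen_decode cN) /=.
  by congr (<<_>>)%g; apply/setP => u; rewrite !inE.
have E0 : 1%G = decode_group (code_group [::]).
  apply: group_inj; rewrite -(gen_decode (isT : [::] \in nine_gens)) /=.
  by rewrite (_ : [set u in _] = set0) ?gen0 //; apply/setP => u; rewrite !inE.
have D n (co : coprime 333 n) c := @decode_res c n co.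
have d73 := D 73%N isT (0, 18)%N isT isT.
have d112 := D 112%N isT (1, 0)%N isT isT.
have d10 := D 10%N isT (0, 24)%N isT isT.
have d121 := D 121%N isT (1, 24)%N isT isT.
have d211 := D 211%N isT (1, 12)%N isT isT.
have d85 := D 85%N isT (1, 30)%N isT isT.
rewrite /nine_subgroups E0 (E1 (0, 18)%N _ _ isT d73) (E1 (1, 0)%N _ _ isT d112).
rewrite (E1 (0, 24)%N _ _ isT d10) (E1 (1, 24)%N _ _ isT d121) (E1 (1, 12)%N _ _ isT d211).
rewrite (E2 (0, 18)%N (1, 0)%N _ _ _ _ isT d73 d112).
rewrite (E2 (0, 18)%N (1, 30)%N _ _ _ _ isT d73 d85).
by rewrite (E2 (0, 18)%N (1, 24)%N _ _ _ _ isT d73 d121).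
Qed.

(** * Exclusion of the remaining subgroups and the final counts *)

Lemma obstructed_no_legendre (R : realType) (H : {group unit333}) c (a b : 'Z_333 -> R) :
  c \in obstructed_codes -> decode c \in H -> invariant_legendre_pair H a b -> False.
Proof.
move=> cbad cH [/legendre_crt[y [z [yz inv]]] aH bH].
have [|j|yc zc] := inv (FinRing.uval (decode c)); [by move=> j; apply: aH | exact: bH |].
have [c1 c2] : (crt (FinRing.uval (decode c))).1 = 4%:R ^+ c.1 /\
               (crt (FinRing.uval (decode c))).2 = 2%:R ^+ c.2.
  by rewrite -[crt _]/(res _) res_decode.
rewrite {}c1 {}c2 in yc zc; move: cbad yc zc; rewrite !inE.
have e4 : (4%:R : 'Z_9) ^+ 1 == 4%:R by [].
have e7 : (4%:R : 'Z_9) ^+ 2 == 7%:R by [].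
have e16 : (2%:R : 'Z_37) ^+ 4 == 16%:R by [].
have e27 : (2%:R : 'Z_37) ^+ 6 == 27%:R by [].
have e6 : (2%:R : 'Z_37) ^+ 27 == 6%:R by [].
case/or4P => [/eqP->|/eqP->|/eqP->|/or3P[] /eqP->] /= yc zc.
- apply: (no_legendre_4_1 yz) => i g.
    by have := yc i g; rewrite expr1 expr0 mul1r.
  by have := zc i g; rewrite expr1 expr0 mul1r.
- by apply: (@no_legendre_4_16 4 y z isT yz) => i g; [have := yc i g | have := zc i g];
    rewrite (eqP e4) (eqP e16).
- by apply: (@no_legendre_4_16 7 y z isT yz) => i g; [have := yc i g | have := zc i g];
    rewrite (eqP e7) (eqP e16).
- by apply: (no_legendre_1_16 yz) => i g; [have := yc i g | have := zc i g];
    rewrite expr0 mul1r (eqP e16).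
- by apply: (no_legendre_1_27 yz) => i g; [have := yc i g | have := zc i g];
    rewrite expr0 mul1r (eqP e27).
- by apply: (no_legendre_1_6 yz) => i g; [have := yc i g | have := zc i g];
    rewrite expr0 mul1r (eqP e6).
Qed.

Lemma no_invariant_legendre (R : realType) C : C \in code_subgroups -> C \notin nine_codes ->
  ~ exists a b : 'Z_333 -> R, invariant_legendre_pair (decode_group C) a b.
Proof.
have /and5P[_ _ _ _ /and3P[_ _ /allP bad]] := code_checks.
move=> CS CN [a [b ab]]; have := bad C CS; rewrite (negPf CN) => /hasP[c cbad cC].
have cc : c \in codes by have [_ sub _] := code_subgroupsP CS; apply: sub.
by apply: (obstructed_no_legendre cbad _ ab); rewrite (mem_decode_group CS cc).
Qed.

Lemma mem_nine_subgroups C : C \in code_subgroups ->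
  (decode_group C \in nine_subgroups) = (C \in nine_codes).
Proof.
have /and5P[_ _ _ /allP nineS _] := code_checks.
move=> CS; rewrite nine_subgroupsE; apply/mapP/idP => [[D DN]|CN]; last by exists C.
by move/(decode_group_inj CS (nineS D DN)) ->.
Qed.

Theorem theorem3 (R : realType) :
  [/\ #|subgroups U1| = 30%N,
      [/\ {subset nine_subgroups <= subgroups U1},
          uniq nine_subgroups &
          [seq #|gval H| | H <- nine_subgroups]
            = [:: 1; 2; 3; 3; 3; 3; 6; 6; 6]%N],
      (#|[set H in subgroups U1 | H \notin nine_subgroups]| = 21%N
       /\ forall H : {group {unit 'Z_333}},
            H \in subgroups U1 -> H \notin nine_subgroups ->
            ~ exists a b : 'Z_333 -> R, invariant_legendre_pair H a b)
    & (#|[set H in subgroups U1 | (9 <= #|gval H|)%N]| = 19%N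
       /\ forall H : {group {unit 'Z_333}},
            H \in subgroups U1 -> (9 <= #|H|)%N ->
            ~ exists a b : 'Z_333 -> R, invariant_legendre_pair H a b)].
Proof.
have /and5P[uS _ /eqP S30 /allP nineS /and3P[/eqP S21 /eqP S19 _]] := code_checks.
have /and3P[uN /eqP sizeN _] := nine_checks.
have cardN : [seq #|gval H| | H <- nine_subgroups] = [:: 1; 2; 3; 3; 3; 3; 6; 6; 6]%N.
  rewrite nine_subgroupsE -map_comp -sizeN; apply/eq_in_map => C CN.
  exact: card_decode_group (nineS C CN).
have sub_codes H : H \in subgroups U1 -> exists2 C, C \in code_subgroups & H = decode_group C.
  by rewrite mem_subgroups => /mapP.
have none H : H \in subgroups U1 -> H \notin nine_subgroups ->
    ~ exists a b : 'Z_333 -> R, invariant_legendre_pair H a b.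
  move=> /sub_codes[C CS ->]; rewrite (mem_nine_subgroups CS); exact: no_invariant_legendre.
split.
- apply: etrans S30; rewrite -(count_predT code_subgroups) -(card_subgroups_count predT).
  by apply: eq_card => H; rewrite inE andbT.
- split; last exact: cardN.
  + move=> H; rewrite nine_subgroupsE mem_subgroups => /mapP[C CN ->].
    exact: map_f (nineS C CN).
  + rewrite nine_subgroupsE map_inj_in_uniq; first exact: uN.
    by move=> C D CN DN; apply: decode_group_inj (nineS C CN) (nineS D DN).
- split; last exact: none.
  apply: etrans S21; rewrite card_subgroups_count; apply: eq_in_count => C CS /=.
  by rewrite (mem_nine_subgroups CS).
- split=> [|H HU H9].
    apply: etrans S19; rewrite card_subgroups_count; apply: eq_in_count => C CS.
    by rewrite -(card_decode_group CS).
  (* The nine subgroups have order at most 6, so order at least 9 puts H outside them. *)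
  apply: (none H HU); apply: contraL H9 => HN.
  have := map_f (fun H : {group unit333} => #|gval H|) HN; rewrite cardN -ltnNge => small.
  exact: (allP (isT : all (gtn 9) [:: 1; 2; 3; 3; 3; 3; 6; 6; 6]%N) _ small).
Qed.
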